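(* Let $\lambda$ be a non-zero real number and let $r$ be a positive integer. For every integer $n\ge 0$, $$H_{n,\lambda}(x)=\frac{1}{2^{r}}\sum_{k=0}^{n}\Bigg\{\sum_{j=0}^{r}\sum_{l=0}^{[\frac{n-k}{2}]}\frac{(-1)_{l,\lambda}\,(n-k)!\,\binom{r}{j}\binom{n}{k}\,2^{n-2l}}{l!\,(n-k-2l)!}\,(j)_{n-k-2l,\lambda}\Bigg\}\mathcal{E}_{k,\lambda}^{(r)}(x),$$ where $H_{n,\lambda}(x)$ are the degenerate Hermite polynomials, $\mathcal{E}_{k,\lambda}^{(r)}(x)$ are the degenerate Euler polynomials of order $r$, and $[y]$ denotes the greatest integer not exceeding $y$.
   Context: Fix a non-zero real number $\lambda$. The degenerate falling factorials are $(x)_{0,\lambda}=1$ and $(x)_{n,\lambda}=x(x-\lambda)(x-2\lambda)\cdots(x-(n-1)\lambda)$ for $n\ge 1$. The degenerate exponential functions are $e_\lambda^x(t)=(1+\lambda t)^{x/\lambda}=\sum_{n\ge 0}(x)_{n,\lambda}\frac{t^n}{n!}$, regarded as formal power series in $t$, and $e_\lambda(t)=e_\lambda^1(t)$. The degenerate Hermite polynomials $H_{n,\lambda}(x)$ are defined by $$e_\lambda^{-1}(t^2)\, e_\lambda^{x}(2t)=\sum_{n=0}^\infty H_{n,\lambda}(x)\frac{t^n}{n!}.$$ The degenerate Euler polynomials of order $r$ are defined by $$\bigg(\frac{2}{e_\lambda(t)+1}\bigg)^{r}e_\lambda^x(t)=\sum_{n=0}^\infty \mathcal{E}_{n,\lambda}^{(r)}(x)\frac{t^n}{n!}.$$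 *)

(* Defs.v *)
From HB Require Import structures.
From mathcomp Require Import all_boot all_order all_algebra.
From mathcomp Require Import boolp reals.

Set Implicit Arguments.
Unset Strict Implicit.
Unset Printing Implicit Defensive.

Import Order.TTheory GRing.Theory Num.Theory.

Local Open Scope ring_scope.

(* A wrapper around [nat -> A], because MathComp-Analysis already equips
   functions into a ring with the pointwise product. *)
Record fps (A : Type) := Fps { fps_coef :> nat -> A }.

Declare Scope fps_scope.
Delimit Scope fps_scope with fps.
Notation "{ 'fps' A }" := (fps A) (at level 0, format "{ 'fps'  A }") : type_scope.

HB.instance Definition _ (A : Type) := gen_eqMixin {fps A}.
HB.instance Definition _ (A : Type) := gen_choiceMixin {fps A}.

Lemma fpsP (A : Type) (a b : {fps A}) : (forall n, a n = b n) -> a = b.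
Proof. by case: a b => [f] [g] /= fg; congr Fps; apply/funext. Qed.

Section FpsRing.
Variable A : comNzRingType.
Implicit Types a b c : {fps A}.

Definition fps_zero : {fps A} := Fps (fun=> 0).
Definition fps_opp a : {fps A} := Fps (fun n => - a n).
Definition fps_add a b : {fps A} := Fps (fun n => a n + b n).
Definition fps_const (x : A) : {fps A} := Fps (fun n => if n == 0%N then x else 0).
Definition fps_mul a b : {fps A} :=
  Fps (fun n => \sum_(i < n.+1) a i * b (n - i)%N).

Fact fps_addA : associative fps_add.
Proof. by move=> a b c; apply: fpsP => n /=; rewrite addrA. Qed.
Fact fps_addC : commutative fps_add.
Proof. by move=> a b; apply: fpsP => n /=; rewrite addrC. Qed.
Fact fps_add0 : left_id fps_zero fps_add.
Proof. by move=> a; apply: fpsP => n /=; rewrite add0r. Qed.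
Fact fps_addN : left_inverse fps_zero fps_opp fps_add.
Proof. by move=> a; apply: fpsP => n /=; rewrite addNr. Qed.

HB.instance Definition _ := GRing.isZmodule.Build {fps A}
  fps_addA fps_addC fps_add0 fps_addN.

Definition fps_trunc N a : {poly A} := \poly_(i < N) a i.

Lemma fps_mul_trunc N a b n : (n < N)%N ->
  fps_mul a b n = (fps_trunc N a * fps_trunc N b)`_n.
Proof.
move=> ltnN; rewrite coefM /=; apply: eq_bigr => i _.
rewrite !coef_poly (leq_ltn_trans _ ltnN) ?(leq_ltn_trans _ ltnN) ?leq_subr //.
by rewrite -ltnS.
Qed.

Fact fps_mulC : commutative fps_mul.
Proof.
by move=> a b; apply: fpsP => n; rewrite !(@fps_mul_trunc n.+1) // mulrC.
Qed.

Fact fps_mulA : associative fps_mul.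
Proof.
move=> a b c; apply: fpsP => n.
transitivity ((fps_trunc n.+1 a * (fps_trunc n.+1 b * fps_trunc n.+1 c))`_n).
  rewrite coefM; apply: eq_bigr => i _.
  by rewrite (@fps_mul_trunc n.+1) ?ltnS ?leq_subr // coef_poly ltn_ord.
rewrite mulrA coefM; apply: eq_bigr => i _.
by rewrite (@fps_mul_trunc n.+1) // coef_poly ltnS leq_subr.
Qed.

Fact fps_mul1 : left_id (fps_const 1) fps_mul.
Proof.
move=> a; apply: fpsP => n /=; rewrite big_ord_recl mul1r subn0 big1 ?addr0 //.
by move=> i _; rewrite mul0r.
Qed.

Fact fps_mulDl : left_distributive fps_mul fps_add.
Proof.
move=> a b c; apply: fpsP => n /=; rewrite -big_split /=.
by apply: eq_bigr => i _; rewrite mulrDl.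
Qed.

Fact fps_one_neq0 : fps_const 1 != 0 :> {fps A}.
Proof.
by apply/eqP => /(congr1 (fun a : {fps A} => a 0%N)) /eqP; rewrite oner_eq0.
Qed.

HB.instance Definition _ := GRing.Zmodule_isComNzRing.Build {fps A}
  fps_mulA fps_mulC fps_mul1 fps_mulDl fps_one_neq0.

Lemma fps_coefM a b n : (a * b) n = \sum_(i < n.+1) a i * b (n - i)%N.
Proof. by []. Qed.

Definition fps_X : {fps A} := Fps (fun n => (n == 1%N)%:R).

(* Meaningful only when [b 0 = 0]: then [b ^+ k] has no term of degree less
   than [k], so that truncating the sum over [k] at [n] loses nothing. *)
Definition fps_comp a b : {fps A} :=
  Fps (fun n => \sum_(k < n.+1) a k * (b ^+ k) n).

Lemma fps_exp_lt b k n : b 0%N = 0 -> (n < k)%N -> (b ^+ k) n = 0.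
Proof.
move=> b0; elim: k n => // k IHk n ltnk; rewrite exprS fps_coefM big1 // => i _.
have [->|i_gt0] := posnP i; first by rewrite b0 mul0r.
rewrite IHk ?mulr0 //; apply: leq_trans (_ : n <= k)%N; last by rewrite -ltnS.
by rewrite ltn_subrL i_gt0 (leq_trans i_gt0) // -ltnS.
Qed.

Lemma fps_coef_sum I (r : seq I) (P : pred I) (F : I -> {fps A}) n :
  (\sum_(i <- r | P i) F i) n = \sum_(i <- r | P i) F i n.
Proof. by apply: (big_morph (fun a : {fps A} => a n)). Qed.

End FpsRing.

Notation "'T" := (fps_X _) (at level 0) : fps_scope.
Notation "a \oT b" := (fps_comp a b) (at level 50, format "a  \oT  b") : fps_scope.
Local Open Scope fps_scope.

Section FpsUnit.
Variable A : comUnitRingType.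
Implicit Types a b : {fps A}.

Definition fps_unit : {pred {fps A}} := fun a => a 0%N \is a GRing.unit.

(* Geometric series: if [a = a0 (1 - b)] with [b 0 = 0], then
   [a^-1 = a0^-1 (1 + b + b^2 + ...)]. *)
Definition fps_inv a : {fps A} :=
  if a \in fps_unit then
    fps_const (a 0%N)^-1 *
    Fps (fun n => \sum_(k < n.+1) ((1 - fps_const (a 0%N)^-1 * a) ^+ k) n)
  else a.

Lemma fps_geom b : b 0%N = 0 ->
  (1 - b) * Fps (fun n => \sum_(k < n.+1) (b ^+ k) n) = 1.
Proof.
move=> b0; apply: fpsP => n.
have -> : (1 : {fps A}) n = (1 - b ^+ n.+1) n.
  by rewrite -[RHS]/((1 : {fps A}) n - (b ^+ n.+1) n) fps_exp_lt // subr0.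
have -> : 1 - b ^+ n.+1 = (1 - b) * \sum_(k < n.+1) b ^+ k.
  by rewrite -opprB subrX1 -mulNr opprB.
rewrite !fps_coefM.
apply: eq_bigr => i _; congr (_ * _) => /=; rewrite fps_coef_sum.
rewrite (big_ord_widen n.+1 (fun k => (b ^+ k) (n - i)%N)) ?ltnS ?leq_subr //.
rewrite big_mkcond /=; apply: eq_bigr => k _; case: ltnP => // ltk.
by rewrite fps_exp_lt.
Qed.

Fact fps_mulVx : {in fps_unit, left_inverse 1 fps_inv *%R}.
Proof.
move=> a ua; rewrite /fps_inv ua mulrAC -[X in X * _ = 1](subKr 1).
apply: fps_geom; rewrite -[LHS]/(1 - (fps_const (a 0%N)^-1 * a) 0%N).
by rewrite fps_coefM big_ord1 /= mulVr ?subrr.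
Qed.

Fact fps_unitPl a b : b * a = 1 -> fps_unit a.
Proof.
move=> /(congr1 (fun c : {fps A} => c 0%N)); rewrite fps_coefM big_ord1 /= => ba1.
by apply/unitrPr; exists (b 0%N); rewrite mulrC.
Qed.

Fact fps_inv_out : {in [predC fps_unit], fps_inv =1 id}.
Proof. by move=> a; rewrite inE /= /fps_inv => /negbTE ->. Qed.

HB.instance Definition _ := GRing.ComNzRing_hasMulInverse.Build {fps A}
  fps_mulVx fps_unitPl fps_inv_out.

Lemma fps_unitE a : (a \is a GRing.unit) = (a 0%N \is a GRing.unit).
Proof. by []. Qed.

End FpsUnit.

Definition dffact (A : comNzRingType) (lam x : A) (n : nat) : A :=
  \prod_(i < n) (x - i%:R * lam).

Section Degenerate.
Variables (R : realType) (lam : R).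

(* Coefficients are taken in {poly R} so that the exponent can be the
   indeterminate 'X as well as a constant. *)
Definition degexp (x : {poly R}) : {fps {poly R}} :=
  Fps (fun n => n`!%:R^-1 *: dffact lam%:P x n).

(* This is (1 + lam t)^(x / lam): the coefficients are those of the binomial
   series. *)
Lemma degexp_binomial x n : lam != 0 ->
  degexp x n = n`!%:R^-1 *: (lam ^+ n *: \prod_(i < n) (lam^-1 *: x - i%:R)).
Proof.
move=> lam0 /=; congr (_ *: _); rewrite /dffact -[in lam ^+ n](card_ord n).
rewrite -scaler_prodl; apply: eq_bigr => i _.
by rewrite scalerBr scalerA divff // scale1r -[lam *: _]mul_polyC mulrC.
Qed.

Definition hermite (n : nat) : {poly R} :=
  n`!%:R *: ((degexp (-1) \oT 'T ^+ 2) * (degexp 'X \oT (2%:R * 'T))) n.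

Definition euler (r n : nat) : {poly R} :=
  n`!%:R *: ((2%:R / (degexp 1 + 1)) ^+ r * degexp 'X) n.

(* The quotient in [euler] is a genuine one. *)
Lemma degexp1D1_unit : degexp 1 + 1 \is a GRing.unit.
Proof.
rewrite fps_unitE -[X in X \is a _]/(degexp 1 0%N + 1) /= /dffact big_ord0.
rewrite invr1 scale1r -[1 + 1]/(2%:R) -polyC_natr poly_unitE size_polyC coefC /=.
by rewrite pnatr_eq0 /= unitfE pnatr_eq0.
Qed.

End Degenerate.

(* Main.v *)
Require Import Defs.
From mathcomp Require Import all_boot all_order all_algebra.
From mathcomp Require Import reals ring.
Import GRing.Theory Num.Theory.
Local Open Scope ring_scope.

(* Write e for the degenerate exponential. Since e^j(t) e^x(t) = e^(x+j)(t),
   the definition of the Euler polynomials E_k of order r gives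
     2^r e^x(t) = (sum_k E_k t^k / k!) * sum_j C(r,j) e^j(t).
   Substitute 2t for t, multiply by e^-1(t^2), and compare coefficients
   of t^n. *)

Section PowerSeries.
Local Open Scope fps_scope.
Context {A : comNzRingType}.
Implicit Types a b : {fps A}.

Lemma fps_coefD a b n : (a + b) n = a n + b n.
Proof. by []. Qed.

Lemma fps_coefMn a m n : (a *+ m) n = a n *+ m.
Proof. by elim: m => // m IHm; rewrite !mulrS fps_coefD IHm. Qed.

Lemma fps_coef_Xn m n : ('T ^+ m : {fps A}) n = (n == m)%:R.
Proof.
elim: m n => [|m IHm] n; first by rewrite expr0 /=; case: eqP.
rewrite exprS fps_coefM; case: n => [|n].
  by rewrite big_ord1 mul0r.
rewrite !big_ord_recl /= mul0r add0r subSS subn0 mul1r IHm eqSS.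
by rewrite big1 ?addr0 // => i _; rewrite mul0r.
Qed.

(** Only degree [k] can occur in [(m%:R * 'T) ^+ k], with coefficient [m%:R ^+ k], so the sum
    defining the composition reduces to its last term [k = n]. *)
Lemma fps_comp_scale a m n : (a \oT (m%:R * 'T)) n = m%:R ^+ n * a n.
Proof.
have coefXn k : ((m%:R * 'T : {fps A}) ^+ k) n = (n == k)%:R * m%:R ^+ k.
  by rewrite exprMn -!natrX mulr_natl fps_coefMn fps_coef_Xn mulr_natr.
rewrite /= big_ord_recr /= coefXn eqxx mul1r big1 => [|k _].
  by rewrite add0r mulrC.
by rewrite coefXn gtn_eqF ?mul0r ?mulr0.
Qed.

Lemma fps_comp_scaleM a b m :
  (a * b) \oT (m%:R * 'T) = (a \oT (m%:R * 'T)) * (b \oT (m%:R * 'T)).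
Proof.
apply: fpsP => n; rewrite fps_comp_scale !fps_coefM mulr_sumr.
apply: eq_bigr => i _; rewrite !fps_comp_scale mulrACA -exprD subnKC //.
by rewrite -ltnS.
Qed.

Lemma fps_coef_comp_sqrM a b n :
  ((a \oT 'T ^+ 2) * b) n = \sum_(l < n./2.+1) a l * b (n - 2 * l)%N.
Proof.
have coefE i : (a \oT 'T ^+ 2) i = \sum_(l < i.+1) a l * (i == 2 * l)%N%:R.
  by apply: eq_bigr => l _; rewrite -exprM fps_coef_Xn.
pose F i l := a l * (i == 2 * l)%N%:R * b (n - i)%N.
(* Terms with [l > i] vanish, since [i = 2 * l] fails for them; adding them makes the range
   rectangular, so that the sums can be exchanged. *)
transitivity (\sum_(i < n.+1) \sum_(l < n.+1) F i l).
  rewrite fps_coefM; apply: eq_bigr => i _; rewrite coefE mulr_suml.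
  rewrite (big_ord_widen n.+1 (F i)) // big_mkcond; apply: eq_bigr => l _.
  case: ifP => // /negbT; rewrite -leqNgt /F => lt_il.
  by rewrite ltn_eqF ?mulr0 ?mul0r // (leq_trans lt_il) // leq_pmull.
(* For fixed [l] only [i = 2 * l] can contribute, and it lies in the range exactly when
   [l <= n./2]. *)
rewrite exchange_big /= (big_ord_widen n.+1 (fun l => a l * b (n - 2 * l)%N)).
  rewrite [RHS]big_mkcond; apply: eq_bigr => l _; rewrite /F ltnS.
  have -> : (l <= n./2)%N = (2 * l < n.+1)%N.
    by rewrite ltnS mul2n geq_half_double.
  case: ltnP => [lt_ln | le_nl].
    rewrite (bigD1 (Ordinal lt_ln)) //= eqxx mulr1 big1 ?addr0 // => i.
    by rewrite -val_eqE /= => /negPf->; rewrite mulr0 mul0r.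
  rewrite big1 // => i _.
  by rewrite ltn_eqF ?mulr0 ?mul0r // (leq_trans _ le_nl).
by rewrite ltnS -[leqRHS]half_double half_leq // -addnn leq_addr.
Qed.

Lemma fps_comp_scaleMn a m p :
  (a *+ p) \oT (m%:R * 'T) = (a \oT (m%:R * 'T)) *+ p.
Proof.
by apply: fpsP => n; rewrite !(fps_comp_scale, fps_coefMn) mulrnAr.
Qed.

Lemma fps_comp_scale_sum I (s : seq I) (Q : pred I) (F : I -> {fps A}) m :
  (\sum_(i <- s | Q i) F i) \oT (m%:R * 'T) =
  \sum_(i <- s | Q i) (F i \oT (m%:R * 'T)).
Proof.
apply: fpsP => n; rewrite fps_comp_scale !fps_coef_sum mulr_sumr.
by apply: eq_bigr => i _; rewrite fps_comp_scale.
Qed.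

End PowerSeries.

Lemma dffactS (A : comNzRingType) (lam x : A) n :
  dffact lam x n.+1 = dffact lam x n * (x - n%:R * lam).
Proof. by rewrite /dffact big_ord_recr. Qed.

Lemma dffact_polyC (A : comNzRingType) (lam x : A) n :
  dffact lam%:P x%:P n = (dffact lam x n)%:P.
Proof.
rewrite /dffact rmorph_prod; apply: eq_bigr => i _.
by rewrite rmorphB rmorphM rmorph_nat.
Qed.

Section DegenerateExponential.
Context {R : realType} (lam : R).
Implicit Types x y : {poly R}.

Lemma polynatr_eq0 n : ((n%:R : {poly R}) == 0) = (n == 0%N).
Proof. by rewrite -polyC_natr polyC_eq0 pnatr_eq0. Qed.

Lemma degexp0 x : degexp lam x 0%N = 1.
Proof. by rewrite /= /dffact big_ord0 fact0 invr1 scale1r. Qed.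

(** This is the differential equation [(1 + lam t) f' = x f] read on coefficients; with the constant
    term 1 it determines the series. *)
Lemma degexpS x n :
  n.+1%:R * degexp lam x n.+1 = (x - n%:R * lam%:P) * degexp lam x n.
Proof.
rewrite /= dffactS -scalerAr [RHS]mulrC -scalerAl -[in LHS]polyC_natr.
rewrite mul_polyC scalerA factS natrM invfM mulrAC mulVf ?mul1r //.
by rewrite pnatr_eq0.
Qed.

(* Both sides satisfy the recurrence [degexpS] with exponent [x + y]. *)
Lemma degexpD x y : degexp lam (x + y) = degexp lam x * degexp lam y.
Proof.
set a := degexp lam x; set b := degexp lam y.
apply: fpsP; elim=> [|n IHn].
  by rewrite fps_coefM big_ord1 !degexp0 mulr1.
have n1_neq0 : (n.+1%:R : {poly R}) != 0 by rewrite polynatr_eq0.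
apply: (mulfI n1_neq0); rewrite degexpS IHn !fps_coefM !mulr_sumr.
(* Leibniz rule: the weight [n.+1] is split as [i + (n.+1 - i)]. The terms [i = 0] of the first sum
   and [i = n.+1] of the second are zero; after dropping them, [degexpS] applies to each factor and
   [(x - i lam) + (y - (n - i) lam) = x + y - n lam]. *)
transitivity (\sum_(i < n.+2) i%:R * a i * b (n.+1 - i)%N
              + \sum_(i < n.+2) a i * ((n.+1 - i)%:R * b (n.+1 - i)%N)).
  rewrite [X in _ = X + _]big_ord_recl [X in _ = _ + X]big_ord_recr /= subnn.
  rewrite !mul0r mulr0 add0r addr0.
  rewrite -big_split /=; apply: eq_bigr => i _; rewrite subSS degexpS.
  have le_in : (i <= n)%N by rewrite -ltnS.
  by rewrite subSn // degexpS natrB // -/a -/b; ring.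
rewrite -big_split; apply: eq_bigr => i _ /=.
rewrite natrB; first by ring.
by rewrite -ltnS.
Qed.

Lemma degexp_nat j : degexp lam j%:R = degexp lam 1 ^+ j.
Proof.
elim: j => [|j IHj]; last by rewrite -[j.+1%:R]natr1 degexpD IHj exprSr.
apply: fpsP => -[|n]; first by rewrite degexp0.
by rewrite expr0 /= /dffact big_ord_recl /= mul0r subrr mul0r scaler0.
Qed.

Lemma euler_gf r :
  (Fps (fun k => k`!%:R^-1 *: euler lam r k) : {fps {poly R}})
  = (2%:R / (degexp lam 1 + 1)) ^+ r * degexp lam 'X.
Proof.
apply: fpsP => k.
by rewrite /= /euler scalerA mulVf ?scale1r // pnatr_eq0 -lt0n fact_gt0.
Qed.

(** By the binomial theorem the sum over [j] is [(degexp lam 1 + 1) ^+ r], which cancels the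
    denominator of the Euler generating function because that base is a unit. *)
Lemma degexpX_euler r :
  degexp lam 'X *+ 2 ^ r =
  (Fps (fun k => k`!%:R^-1 *: euler lam r k) : {fps {poly R}})
  * \sum_(j < r.+1) degexp lam j%:R *+ 'C(r, j).
Proof.
rewrite euler_gf -[LHS]mulr_natl natrX.
have -> : \sum_(j < r.+1) degexp lam j%:R *+ 'C(r, j) = (degexp lam 1 + 1) ^+ r.
  rewrite addrC exprDn; apply: eq_bigr => j _.
  by rewrite expr1n mul1r degexp_nat.
by rewrite mulrAC -exprMn divrK // degexp1D1_unit.
Qed.

End DegenerateExponential.

Theorem theorem5 (R : realType) (lam : R) (hlam : lam != 0)
    (r : nat) (hr : (0 < r)%N) (n : nat) :
  hermite lam n =
  (2%:R ^+ r)^-1 *: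
    \sum_(0 <= k < n.+1)
      (\sum_(0 <= j < r.+1) \sum_(0 <= l < ((n - k)./2).+1)
         (dffact lam (-1) l * (n - k)`!%:R * 'C(r, j)%:R * 'C(n, k)%:R
            * 2%:R ^+ (n - 2 * l))
         / (l`!%:R * (n - k - 2 * l)`!%:R)
         * dffact lam j%:R (n - k - 2 * l)) *: euler lam r k.
Proof.
have nfact_neq0 m : (m`!%:R : R) != 0 by rewrite pnatr_eq0 -lt0n fact_gt0.
set P := (degexp lam (-1) \oT 'T ^+ 2)%fps.
set E : {fps {poly R}} := Fps (fun k => k`!%:R^-1 *: euler lam r k).
(* [P] is grouped with the powers [degexp lam j%:R], not with [E]: the outer Cauchy product then
   runs over the index [k] of the Euler polynomials, and the sum over [l] arises inside each
   factor. *)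
have gfE : (P * (degexp lam 'X \oT (2%:R * 'T))%fps) *+ 2 ^ r =
    (E \oT (2%:R * 'T))%fps *
    \sum_(j < r.+1) (P * (degexp lam j%:R \oT (2%:R * 'T))%fps) *+ 'C(r, j).
  have := congr1 (fun a => P * (a \oT (2%:R * 'T))%fps) (degexpX_euler lam r).
  rewrite fps_comp_scaleM fps_comp_scaleMn fps_comp_scale_sum -/E.
  rewrite mulrnAr mulrCA => ->.
  congr (_ * _); rewrite mulr_sumr; apply: eq_bigr => j _.
  by rewrite fps_comp_scaleMn mulrnAr.
have pow2_neq0 : (2%:R ^+ r : R) != 0 by rewrite expf_neq0 // pnatr_eq0.
apply: (scalerI pow2_neq0); rewrite [RHS]scalerA divff // scale1r /hermite.
rewrite scalerA mulrC -scalerA -natrX [(2 ^ r)%:R *: _]scaler_nat.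
rewrite -fps_coefMn -/P gfE fps_coefM.
rewrite scaler_sumr big_mkord; apply: eq_bigr => k _.
have le_kn : (k <= n)%N by rewrite -ltnS.
rewrite fps_comp_scale [fps_coef E k]/= mulrC.
(* The exponents [-1] and [j] are constants, so these coefficients are constant polynomials and can
   act as scalars on [euler lam r k]. *)
have coefj j : (P * (degexp lam j%:R \oT (2%:R * 'T))%fps) (n - k)%N =
   (\sum_(0 <= l < ((n - k)./2).+1) dffact lam (-1) l / l`!%:R
     * 2%:R ^+ (n - k - 2 * l) * (dffact lam j%:R (n - k - 2 * l)
        / (n - k - 2 * l)`!%:R))%:P.
  rewrite fps_coef_comp_sqrM big_mkord rmorph_sum; apply: eq_bigr => l _.
  rewrite fps_comp_scale /= -[-1]/(- 1%:P) -polyCN -polyC_natr !dffact_polyC.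
  rewrite -[2%:R]polyC_natr -polyC_exp -!mul_polyC -!polyCM.
  by congr _%:P; ring.
rewrite fps_coef_sum.
under eq_bigr => j _ do rewrite fps_coefMn coefj -polyCMn.
rewrite -[X in X * _]rmorph_sum; move: (euler lam r k) => e.
rewrite -[X in X ^+ k]polyC_natr -polyC_exp !mul_polyC !scalerA.
congr (_ *: e); rewrite big_mkord !(mulr_sumr, mulr_suml).
apply: eq_bigr => j _; rewrite -sumrMnl !(mulr_sumr, mulr_suml).
apply: eq_big_nat => l; rewrite ltnS geq_half_double -mul2n => /andP[_ le_l].
(* Of the power [2 ^ (n - 2 * l)], the part [2 ^ k] comes from [E] at [2t] and the rest from
   [degexp lam j%:R] at [2t]. The bound on [l] keeps the subtractions exact. *)
have -> : (n - 2 * l = k + (n - k - 2 * l))%N.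
  by rewrite addnBA // subnKC.
(* Writing [n!] as ['C(n, k) * (k! * (n - k)!)] produces the binomial coefficient, and [k!] cancels
   the denominator in [E]. *)
rewrite -(bin_fact le_kn) !natrM -mulr_natr exprD invfM.
by field; rewrite !nfact_neq0.
Qed.
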